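(* Let $d$ be a natural number such that $d\ge 2$. For $1\le i\le d$, let $X_{(i)}$ be the $i$-th order statistic of a statistical sample of size $d$ (that is, of independent and identically distributed random variables $X_1,\ldots,X_d$) from a decreasing failure rate (DFR) distribution function $F$, with density function $f$. Then, for every $(i,j)$ such that $1\le i<j\le d$, the random variable $X_{(j)}-X_{(i)}$ is positive regression dependent in $X_{(i)}$, i.e., ${\rm PRD}(X_{(j)}-X_{(i)}\,|\,X_{(i)})$ holds.
   Context: The $i$-th order statistic $X_{(i)}$ is the $i$-th smallest value among $X_1,\ldots,X_d$ (so $X_{(1)}=\min\{X_1,\ldots,X_d\}$ and $X_{(d)}=\max\{X_1,\ldots,X_d\}$). DFR: let $X$ be a random variable with distribution function $F$. Then $F$ is said to be decreasing failure rate (DFR) if $\mathbb{P}[X>x+y\mid X>x]$ is a nondecreasing function of $x$ for all $y\ge 0$; equivalently, writing $\overline{F}(x)=1-F(x)$, if $\overline{F}(x+y)/\overline{F}(x)$ is nondecreasing in $x$ for all $y\ge 0$. Positive regression dependence: for random variables $X$ and $Y$, $Y$ is positive regression dependent in $X$, written ${\rm PRD}(Y|X)$, if $\mathbb{P}[Y>y\mid X=x]$ is a nondecreasing function of $x$ for all $y\ge 0$. *)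

(* Defs.v *)
From HB Require Import structures.
From mathcomp Require Import all_boot all_order all_algebra.
From mathcomp Require Import all_classical all_reals all_analysis.
From mathcomp Require Import measurable_realfun.

Set Implicit Arguments.
Unset Strict Implicit.
Unset Printing Implicit Defensive.

Import Order.TTheory GRing.Theory Num.Theory.
Import numFieldNormedType.Exports.

Local Open Scope classical_set_scope.
Local Open Scope ring_scope.

Section distribution_functions.
Context {R : realType}.
Implicit Types (F f : R -> R) (x y : R).

(* The support of the law with distribution function F: the points of
   increase of F. *)
Definition cdf_support F : set R :=
  [set x | forall e, 0 < e -> F (x - e) < F (x + e)].

Definition survival F x : R := 1 - F x.

(* P[X > x + y | X > x] only makes sense where survival F x > 0, and x ranges
   over the support of F: over the whole real line, the monotonicity would hold
   for no distribution function, because the ratio tends to 1 as x tends to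
   -oo. For a lifetime distribution with support [0, +oo[, this is the usual
   range x >= 0. *)
Definition DFR F : Prop :=
  forall y, 0 <= y ->
    {in [set x | cdf_support F x /\ 0 < survival F x] &,
      {homo (fun x => survival F (x + y) / survival F x) :
        x1 x2 / x1 <= x2}}.

Definition is_density F f : Prop :=
  [/\ measurable_fun [set: R] f, forall t, 0 <= f t &
      forall x, ((F x)%:E = \int[lebesgue_measure]_(t in `]-oo, x]) (f t)%:E)%E].

End distribution_functions.

Section order_statistics.
Context {disp : measure_display} {T : measurableType disp} {R : realType}.
Variables (d : nat) (X : 'I_d -> {mfun T >-> R}) (i : nat).

(* The i-th smallest of the d values, counted with multiplicity and numbered
   from 1; a dummy value unless 1 <= i <= d. *)
Definition order_stat (w : T) : R :=
  nth 0 (sort <=%O [seq X k w | k <- enum 'I_d]) i.-1.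

Let measurable_order_stat : measurable_fun [set: T] order_stat.
Proof.
have [di|id] := leqP d i.-1.
  rewrite (_ : order_stat = cst 0)//; apply/funext => w.
  by rewrite /order_stat nth_default// size_sort size_map size_enum_ord.
apply: (measurability _ (RGenOInfty.measurableE R)) => _ [_ [r ->] <-].
rewrite setTI.
rewrite (_ : _ @^-1` _ = ~` \bigcup_(J in [set J : {set 'I_d} | (i.-1 < #|J|)%N])
    \bigcap_(k in [set` J]) (X k @^-1` `]-oo, r])); last first.
  apply/seteqP; split => w /=; rewrite in_itv/= andbT.
    move=> wr [J /= iJ JX]; move: wr; apply/negP; rewrite -leNgt.
    apply: nth_count_le; first exact: (sort_sorted le_total).
    rewrite (permP (permEl (perm_sort _ _))) count_map.
    rewrite (leq_trans iJ)// cardE -size_filter.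
    rewrite (uniq_leq_size (enum_uniq _))// => k; rewrite mem_enum => kJ.
    rewrite mem_filter mem_enum inE andbT /=.
    by have := JX k kJ; rewrite /= in_itv.
  move=> wr; apply: nth_count_gt; first exact: (sort_sorted le_total).
  rewrite size_sort size_map size_enum_ord id andbT leqNgt.
  apply/negP => ic; apply: wr; exists [set k | X k w <= r]%SET => /=.
    move: ic; rewrite (permP (permEl (perm_sort _ _))) count_map -size_filter.
    move=> /leq_trans; apply; rewrite cardE uniq_leq_size//.
      by rewrite filter_uniq// enum_uniq.
    by move=> k; rewrite mem_filter !mem_enum !inE andbT.
  by move=> k /=; rewrite inE in_itv.
apply: measurableC; apply: fin_bigcup_measurable => //.
move=> J _; apply: fin_bigcap_measurable => // k _.
by rewrite -[X in measurable X]setTI; exact: measurable_funPT.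
Qed.

HB.instance Definition _ :=
  isMeasurableFun.Build _ _ _ _ order_stat measurable_order_stat.

End order_statistics.

Section dependence.
Context {disp : measure_display} {T : measurableType disp} {R : realType}.
Variable P : probability T R.
Local Open Scope ereal_scope.

Definition mutually_independent (I : finType) (X : I -> {RV P >-> R}) : Prop :=
  forall (J : {set I}) (A : I -> set R), (forall k, measurable (A k)) ->
    P (\bigcap_(k in [set` J]) (X k @^-1` A k)) =
    \prod_(k in J) P (X k @^-1` A k).

Definition is_regular_conditional_distribution (Y X : {RV P >-> R})
    (kappa : R.-pker measurableTypeR R ~> measurableTypeR R) : Prop :=
  forall A B : set R, measurable A -> measurable B ->
    P (X @^-1` A `&` Y @^-1` B) =
    \int[distribution P X]_(x in A) kappa x B.

(* P[Y > y | X = x] is kappa x `]y, +oo[ for a single version kappa of the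
   conditional distribution of Y given X = x, with x in the support of X (off
   the support, these conditional probabilities are arbitrary). *)
Definition PRD (Y X : {RV P >-> R}) : Prop :=
  exists2 kappa, is_regular_conditional_distribution Y X kappa &
    forall y : R, (0 <= y)%R ->
      {in cdf_support (fine \o cdf X) &,
        {homo (fun x : R => kappa x `]y, +oo[%classic) :
          x1 x2 / (x1 <= x2)%R >-> x1 <= x2}}.

End dependence.

Arguments mutually_independent {disp T R} P {I} X.
Arguments PRD {disp T R} P Y X.

(* Main.v *)
Require Import Defs.
From HB Require Import structures.
From mathcomp Require Import all_boot all_order all_algebra.
From mathcomp Require Import all_classical all_reals all_analysis.
From mathcomp Require Import measurable_realfun.
From mathcomp Require Import ring lra zify.

(* Breaking ties by the index, exactly one index k is the i-th one, and then
   X_(i) = X_k. Given X_k = x, the other variables fall below x with probability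
   F x, and the event X_(j) - X_(i) > y only depends on how many of them exceed
   x + y. Hence X_(i) has density proportional to F^(i-1) (1 - F)^(d-i) with
   respect to the law of one observation and, given X_(i) = x, the gap is the
   (j-i)-th order statistic of d - i observations conditioned to exceed x, minus
   x. It exceeds y with the probability that at least d - j + 1 of d - i
   independent trials succeed, the success probability being
   (1 - F (x + y)) / (1 - F x). This is monotone in the success probability,
   which the DFR property makes monotone in x. Finally, F < 1 on its support: a
   continuous DFR law has no largest support point. *)

Set Implicit Arguments.
Unset Strict Implicit.
Unset Printing Implicit Defensive.
Import Order.TTheory GRing.Theory Num.Theory.
Import numFieldNormedType.Exports.
Import HBNNSimple.
Local Open Scope classical_set_scope.
Local Open Scope ring_scope.

(** * Integration against a measure that has a density *)

Lemma ge0_integral_density d (T : measurableType d) (R : realType)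
    (mu nu : {measure set T -> \bar R}) (h : T -> R) (f : T -> \bar R) E :
  measurable_fun [set: T] h -> (forall x, 0 <= h x) ->
  (forall A, measurable A -> nu A = \int[mu]_(x in A) (h x)%:E)%E ->
  measurable E -> measurable_fun [set: T] f -> (forall x, 0 <= f x)%E ->
  (\int[nu]_(x in E) f x = \int[mu]_(x in E) (f x * (h x)%:E))%E.
Proof.
move=> mh h0 nuE mE mf f0.
have mhE : measurable_fun [set: T] (EFin \o h) by exact/measurable_EFinP.
(* Simple functions increase to [f], and monotone convergence passes to the limit on both sides.
   Linearity then leaves indicators, for which the formula is the hypothesis on [nu]. *)
pose g := nnsfun_approx measurableT mf.
have gf (x : T) : (g n x)%:E @[n --> \oo] --> f x.
  exact: (cvg_nnsfun_approx measurableT mf (fun x _ => f0 x)).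
have ndg (x : T) : {homo (fun n => g n x) : m n / (m <= n)%N >-> m <= n}.
  by move=> m n mn; exact/lefP/nd_nnsfun_approx.
transitivity (limn (fun n => \int[nu]_(x in E) (g n x)%:E)%E).
  rewrite -monotone_convergence//.
  - by apply: eq_integral => x _; apply/esym/cvg_lim => //; exact: gf.
  - by move=> n; exact/measurable_EFinP/measurable_funTS.
  - by move=> n x _; rewrite lee_fin.
  - by move=> x _ m n mn; rewrite lee_fin ndg.
transitivity (limn (fun n => \int[mu]_(x in E) ((g n x)%:E * (h x)%:E))%E);
    last first.
  rewrite -monotone_convergence//.
  - apply: eq_integral => x _; apply: cvg_lim => //.
    by apply: cvgeZr => //; exact: gf.
  - by move=> n; apply: emeasurable_funM; apply: measurable_funTS => //;
      exact/measurable_EFinP.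
  - by move=> n x _; rewrite mule_ge0 ?lee_fin.
  - by move=> x _ m n mn; rewrite lee_wpmul2r ?lee_fin ?ndg.
apply: congr_lim; apply/funext => n.
under eq_integral do rewrite fimfunE -fsumEFin//.
have mind r : measurable_fun E (fun x => (r * \1_(g n @^-1` [set r]) x)%:E).
  by apply: measurable_funTS; apply/measurable_EFinP; exact: measurable_funM.
rewrite ge0_integral_fsum//; last by move=> r x Ex; exact: nnfun_muleindic_ge0.
under [RHS]eq_integral => x _.
  rewrite fimfunE -fsumEFin// ge0_mule_fsuml//; last first.
    by move=> r; exact: nnfun_muleindic_ge0.
  over.
rewrite ge0_integral_fsum//; last 2 first.
- by move=> r; apply: emeasurable_funM => //; exact: measurable_funTS.
- by move=> r x Ex; rewrite mule_ge0 ?lee_fin//; exact: nnfun_muleindic_ge0.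
apply: eq_fsbigr => r /[!inE] -[x _ <-].
rewrite (_ : (fun _ => _) =
    fun z => ((g n x)%:E * (\1_(g n @^-1` [set g n x]) z)%:E)%E); last first.
  by apply/funext => z; rewrite EFinM.
under [RHS]eq_integral do rewrite EFinM -muleA.
rewrite ge0_integralZl ?lee_fin//; last first.
  by apply: measurable_funTS; exact/measurable_EFinP.
rewrite ge0_integralZl ?lee_fin//; last 2 first.
- by apply: emeasurable_funM; apply: measurable_funTS => //;
    exact/measurable_EFinP.
- by move=> z _; rewrite mule_ge0 ?lee_fin.
congr (_ * _)%E.
rewrite integral_indic// nuE; last by exact: measurableI.
rewrite setIC integral_mkcondr epatch_indic.
by apply: eq_integral => z _; rewrite muleC.
Qed.

(** * Counts of independent trials with three possible outcomes *)

Definition countset (I : eqType) (T : Type) (B V : I -> set T) (s : seq I)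
    (a r : nat) : set T :=
  [set w | count (fun l => w \in B l) s = a /\
           (r <= count (fun l => w \in V l) s)%N].

Section countset.
Context (I : eqType) (T : Type) (B V : I -> set T).
Hypothesis BV : forall l, B l `&` V l = set0.

Lemma countset_nil a r :
  countset B V [::] a r = if (a == 0%N) && (r == 0%N) then setT else set0.
Proof.
apply/seteqP; split => w; rewrite /countset /= leqn0.
  by case=> <- ->.
by case: ifP => // /andP[/eqP-> ->].
Qed.

(** Disjointness of [B l] and [V l] makes this a split into three exclusive cases. In the
    application [B l] says that variable [l] falls below x, which determines a rank, and [V l] that
    it exceeds x + y, which bounds a gap from below. *)
Lemma countset_cons l s a r : countset B V (l :: s) a r =
  (B l `&` (if a is a'.+1 then countset B V s a' r else set0)) `|`
  (V l `&` countset B V s a r.-1) `|`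
  (~` (B l `|` V l) `&` countset B V s a r).
Proof.
apply/seteqP; split=> w; rewrite /countset/=.
  have [wB|wB] := boolP (w \in B l).
    have wV : w \notin V l.
      by apply/negP; rewrite !inE in wB * => wV; have : (B l `&` V l) w by []; rewrite BV.
    rewrite (negbTE wV) add0n => -[<- ?]; left; left.
    by rewrite inE in wB; split.
  have [wV [<- rV]|wV] := boolP (w \in V l).
    left; right; rewrite inE in wV; split => //; split => //.
    by rewrite -subn1 leq_subLR.
  rewrite !add0n => ?; right; split => //.
  by rewrite notin_setE in wB; rewrite notin_setE in wV; case.
move=> [[[wB]|[wV [<- rV]]]|[/not_orP[wB wV] ?]].
- case: a => // a [<- rV]; rewrite mem_set//; split => //.
  by rewrite (leq_trans rV)// leq_addl.
- rewrite (memNset (A := B l)) ?mem_set//; first by split => //; lia.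
  by move=> wB; have : (B l `&` V l) w by []; rewrite BV.
- by rewrite !memNset.
Qed.

End countset.

Lemma measurable_countset (I : eqType) d (T : measurableType d)
    (B V : I -> set T) s a r : (forall l, B l `&` V l = set0) ->
  {in s, forall l, measurable (B l)} -> {in s, forall l, measurable (V l)} ->
  measurable (countset B V s a r).
Proof.
move=> BV; elim: s a r => [|l s IH] a r mB mV.
  by rewrite countset_nil; case: ifP.
have mBl : measurable (B l) by apply: mB; rewrite mem_head.
have mVl : measurable (V l) by apply: mV; rewrite mem_head.
have {}IH a' r' : measurable (countset B V s a' r').
  by apply: IH => k ks; [apply: mB|apply: mV]; rewrite inE ks orbT.
rewrite countset_cons//; apply: measurableU; first apply: measurableU.
- by apply: measurableI => //; case: a.
- exact: measurableI.
- by apply: measurableI => //; apply: measurableC; exact: measurableU.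
Qed.

(** A trinomial tail: when b + p + q = 1, this is the probability that [n] independent trials give
    exactly [a] outcomes of weight [b] and at least [r] of weight [p]. The recursion conditions on
    one trial, as [countset_cons] does; the truncation of [r.-1] at 0 suits a lower bound. *)
Fixpoint count_prob (R : pzRingType) (b p q : R) (n a r : nat) : R :=
  if n is n'.+1 then
    (if a is a'.+1 then b * count_prob b p q n' a' r else 0) +
    p * count_prob b p q n' a r.-1 + q * count_prob b p q n' a r
  else ((a == 0%N) && (r == 0%N))%:R.

(** Induction on [s]. The constraints indexed by [J] make it work: the head of [s] joins [J] with
    its outcome as constraint, so that independence is invoked only once [s] is empty. *)
Lemma prob_countset d (T : measurableType d) (R : realType)
    (P : probability T R) (I : finType) (X : I -> {RV P >-> R})
    (B V : I -> set R) (b p q : R) (s : seq I) (J : {set I}) (A : I -> set R)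
    (a r : nat) :
  mutually_independent P X ->
  (forall l, B l `&` V l = set0) ->
  (forall l, measurable (B l)) -> (forall l, measurable (V l)) ->
  (forall l, l \in s -> P (X l @^-1` B l) = b%:E) ->
  (forall l, l \in s -> P (X l @^-1` V l) = p%:E) ->
  (forall l, l \in s -> P (X l @^-1` (~` (B l `|` V l))) = q%:E) ->
  uniq s -> (forall l, l \in s -> l \notin J) -> (forall l, measurable (A l)) ->
  P (\bigcap_(l in [set` J]) (X l @^-1` A l) `&`
     countset (fun l => X l @^-1` B l) (fun l => X l @^-1` V l) s a r) =
  ((\prod_(l in J) P (X l @^-1` A l)) * (count_prob b p q (size s) a r)%:E)%E.
Proof.
move=> indX BV mB mV.
have mX l C : measurable C -> measurable (X l @^-1` C).
  exact: measurable_funPTI.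
have BVX l : (X l @^-1` B l) `&` (X l @^-1` V l) = set0.
  by rewrite -preimage_setI BV preimage_set0.
elim: s J A a r => [|l s IH] J A a r Pb Pp Pq.
  move=> _ _ mA; rewrite countset_nil /=; case: ifP => _ /=.
    by rewrite setIT mule1 indX.
  by rewrite setI0 measure0 mule0.
rewrite /= => /andP[ls us] sJ mA; rewrite countset_cons//.
set D := \bigcap_(_ in _) _.
have mD : measurable D by apply: fin_bigcap_measurable => // k _; exact: mX.
have mc a' r' : measurable (countset (fun l => X l @^-1` B l)
    (fun l => X l @^-1` V l) s a' r').
  by apply: measurable_countset => // k _; exact: mX.
have lJ : l \notin J by apply: sJ; rewrite mem_head.
have step C (c : R) a' r' : measurable C -> P (X l @^-1` C) = c%:E ->
  P (D `&` (X l @^-1` C `&` countset (fun l => X l @^-1` B l)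
    (fun l => X l @^-1` V l) s a' r')) =
  ((\prod_(l in J) P (X l @^-1` A l)) * (c * count_prob b p q (size s) a' r')%:E)%E.
  move=> mC Pc; pose A' k := if k == l then C else A k.
  have A'J k : k \in J -> A' k = A k.
    by rewrite /A'; case: eqP => // -> kJ; rewrite kJ in lJ.
  have -> : D `&` (X l @^-1` C `&` countset (fun l => X l @^-1` B l)
    (fun l => X l @^-1` V l) s a' r') =
    \bigcap_(k in [set` (l |: J)%SET]) (X k @^-1` A' k) `&`
    countset (fun l => X l @^-1` B l) (fun l => X l @^-1` V l) s a' r'.
    rewrite setIA; congr (_ `&` _); apply/seteqP; split => w /=.
      move=> [Dw Cw] k /=; rewrite in_setU1 => /orP[/eqP->|kJ].
        by rewrite /A' eqxx.
      by rewrite A'J//; exact: Dw.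
    move=> H; split; last by have := H l; rewrite /= setU11 /A' eqxx; exact.
    by move=> k /= kJ; rewrite -(A'J k kJ); apply: H; rewrite /= setU1r.
  rewrite IH//; last 5 first.
  - by move=> k ks; apply: Pb; rewrite inE ks orbT.
  - by move=> k ks; apply: Pp; rewrite inE ks orbT.
  - by move=> k ks; apply: Pq; rewrite inE ks orbT.
  - move=> k ks; rewrite in_setU1 negb_or sJ ?inE ?ks ?orbT// andbT.
    by apply: contraNneq ls => <-.
  - by move=> k; rewrite /A'; case: ifP.
  rewrite big_setU1//= {1}/A' eqxx Pc EFinM muleA; congr (_ * _)%E.
  by rewrite muleC; congr (_ * _)%E; apply: eq_bigr => k kJ; rewrite A'J.
rewrite !setIUr measureU; last 3 first.
- by apply: measurableU; apply: measurableI => //; apply: measurableI => //;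
    [exact: mX|case: (a)|exact: mX].
- apply: measurableI => //; apply: measurableI => //.
  by apply: measurableC; apply: measurableU; exact: mX.
- apply/seteqP; split => // w [] [] [_ [h _]] [_ [h' _]]; apply: h'; [by left|by right].
rewrite measureU; last 3 first.
- by apply: measurableI => //; apply: measurableI => //; [exact: mX|case: (a)].
- by apply: measurableI => //; apply: measurableI => //; exact: mX.
- apply/seteqP; split => // w [[_ [h _]] [_ [h' _]]].
  by rewrite -(BVX l).
have fP : (\prod_(l in J) P (X l @^-1` A l))%E \is a fin_num.
  by apply: prode_fin_num => k _; apply: fin_num_measure; exact: mX.
rewrite !EFinD !muleDr//; congr (_ + _ + _)%E.
- case: (a) => [|a']; first by rewrite setI0 setI0 measure0 mule0.
  by apply: step => //; apply: Pb; rewrite mem_head.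
- by apply: step => //; apply: Pp; rewrite mem_head.
- apply: (step (~` (B l `|` V l))).
    by apply: measurableC; exact: measurableU.
  by apply: Pq; rewrite mem_head.
Qed.

(** * Algebra and monotonicity of the trinomial tail *)

Section count_prob.
Context {R : realDomainType}.
Implicit Types b p q c : R.

(** The coefficient chooses which [a] trials have the first outcome, and the recursion is Pascal's
    rule. For [a] above [n] the coefficient vanishes, so the truncated subtraction is harmless. *)
Lemma count_prob_binomial b p q n a r :
  count_prob b p q n a r =
  'C(n, a)%:R * (b ^+ a * count_prob b p q (n - a) 0 r).
Proof.
elim: n a r => [|n IH] [|a] r; rewrite ?bin0 ?expr0 ?mul1r ?subn0//.
  by rewrite bin0n /= mul0r.
rewrite subSS /= !IH binS natrD.
have [an|na] := ltnP a n; last first.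
  by rewrite (@bin_small n a.+1) ?ltnS// exprS; ring.
have e : (n - a = (n - a.+1).+1)%N by lia.
by rewrite e /= exprS; ring.
Qed.

(** When no trial has the first outcome, each of the [n] trials contributes one factor [p] or [q].
    This homogeneity later divides out the probability that all the observations exceed x. *)
Lemma count_probZ b p q c n r :
  count_prob b (c * p) (c * q) n 0 r = c ^+ n * count_prob b p q n 0 r.
Proof.
elim: n r => [|n IH] r /=; first by rewrite mul1r.
by rewrite !IH exprS; ring.
Qed.

Lemma count_prob0 b p q n : count_prob b p q n 0 0 = (p + q) ^+ n.
Proof. by elim: n => [//|n /= ->]; rewrite exprS; ring. Qed.

Lemma count_prob_0 b b' p q n r :
  count_prob b p q n 0 r = count_prob b' p q n 0 r.
Proof. by elim: n r => [//|n IH] r /=; rewrite !IH. Qed.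

Lemma count_prob_ge0 b p q n a r : 0 <= b -> 0 <= p -> 0 <= q ->
  0 <= count_prob b p q n a r.
Proof.
move=> b0 p0 q0; elim: n a r => [|n IH] a r /=; first by rewrite ler0n.
by rewrite !addr_ge0 ?mulr_ge0//; case: a => // a; rewrite mulr_ge0.
Qed.

Lemma count_prob_nonincreasing b p q n r : 0 <= p -> 0 <= q ->
  count_prob b p q n 0 r <= count_prob b p q n 0 r.-1.
Proof.
move=> p0 q0; elim: n r => [|n IH] r /=; first by case: r => [|[|r]] //=; rewrite ler01.
by rewrite !add0r lerD// ler_wpM2l.
Qed.

(** Condition on one trial: the induction hypothesis improves both branches, and moving the weight
    p' - p from failure to success helps because a success lowers the number still required. *)
Lemma count_prob_homo b p p' n r : 0 <= p -> p <= p' -> p' <= 1 ->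
  count_prob b p (1 - p) n 0 r <= count_prob b p' (1 - p') n 0 r.
Proof.
move=> p0 pp' p'1; elim: n r => [//|n IH] r /=.
have := IH r; have := IH r.-1.
have : count_prob b p' (1 - p') n 0 r <= count_prob b p' (1 - p') n 0 r.-1.
  by apply: count_prob_nonincreasing; lra.
move: (count_prob _ p _ _ _ r) (count_prob _ p _ _ _ r.-1) => u v.
move: (count_prob _ p' _ _ _ r) (count_prob _ p' _ _ _ r.-1) => u' v'.
by nra.
Qed.

End count_prob.

(** * Freezing the value of one of several independent variables *)

Section disintegration.
Context d (T : measurableType d) (R : realType) (P : probability T R).
Context (I : finType) (X : I -> {RV P >-> R}) (k : I).

Definition cylinder : set (set (R * T)) :=
  [set C | exists A B, [/\ measurable A, forall l, measurable (B l) &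
     C = A `*` \bigcap_(l in [set l | l != k]) (X l @^-1` B l)]].

Let mX l C : measurable C -> measurable (X l @^-1` C).
Proof. exact: measurable_funPTI. Qed.

Let mbig (B : I -> set R) : (forall l, measurable (B l)) ->
  measurable (\bigcap_(l in [set l | l != k]) (X l @^-1` B l)).
Proof.
move=> mB; apply: fin_bigcap_measurable => [|l _]; last exact: mX.
exact: sub_finite_set (@finite_finpred _ _ (@predT I)).
Qed.

(* The law of (X_k, id) on R * T is not a product, but it agrees with the product
   of the marginals on the pi-system of the events only involving X_k and the
   [X l], [l != k]. *)
Lemma independent_disintegration (D : set (R * T)) :
  mutually_independent P X -> <<s cylinder >> D ->
  P [set w | D (X k w, w)] = (\int[distribution P (X k)]_x P (xsection D x))%E.
Proof.
move=> indX; pose g (w : T) := (X k w, w).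
have mg : measurable_fun [set: T] g by exact: measurable_fun_pair.
pose gm : {mfun T >-> (R * T)%type} := HB.pack g (isMeasurableFun.Build _ _ _ _ g mg).
move=> sD; rewrite -[LHS]/(pushforward P gm D).
rewrite -[RHS]/((distribution P (X k) \x P)%E D).
apply: (g_sigma_algebra_measure_unique cylinder _ (fun=> setT)) => //.
- move=> _ [A [B [mA mB ->]]]; apply: measurableX => //; exact: mbig.
- move=> _; exists setT, (fun=> setT); split => //.
  by rewrite bigcapT ?setXTT.
- by rewrite bigcup_const.
- move=> _ _ [A [B [mA mB ->]]] [A' [B' [mA' mB' ->]]].
  exists (A `&` A'), (fun l => B l `&` B' l); split.
  + exact: measurableI.
  + by move=> l; exact: measurableI.
  + by rewrite -setXI -bigcapI.
- move=> _ [A [B [mA mB ->]]].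
  rewrite [RHS](product_measure1E (distribution P (X k)) P mA (mbig mB)).
  (* Placing [A] at index [k] gives the joint event, and placing [setT] there gives the event on the
     other indices alone; independence then factors both. *)
  pose B' A l := if l == k then A else B l.
  have mB' A' l : measurable A' -> measurable (B' A' l) by rewrite /B'; case: eqP.
  have B'k A' : B' A' k = A' by rewrite /B' eqxx.
  have big A' : X k @^-1` A' `&` \bigcap_(l in [set l | l != k]) (X l @^-1` B l) =
      \bigcap_(l in [set` [set: I]%SET]) (X l @^-1` B' A' l).
    apply/seteqP; split => w /=.
      move=> [Aw Bw] l /= _; rewrite /B'; have [->//|lk] := eqVneq l k.
      exact: Bw.
    move=> H; split.
      by have := H k; rewrite /B' /= eqxx; apply; rewrite inE.
    move=> l lk; have := H l; rewrite /B' /= (negbTE lk); apply.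
    by rewrite inE.
  rewrite -[LHS]/(P (X k @^-1` A `&` _)) big indX ?inE//; last by move=> l; exact: mB'.
  rewrite (bigD1 k)//= B'k; congr (_ * _)%E.
  rewrite -[X in P X]setTI -(preimage_setT (X k)) big indX//; last by move=> l; exact: mB'.
  rewrite [in RHS](bigD1 k)//= B'k preimage_setT probability_setT mul1e.
  by apply: eq_bigr => l /andP[_ /negbTE lk]; rewrite /B' lk.
- move=> _; apply: (@le_lt_trans _ _ 1%E); last exact: ltry.
  by have := probability_le1 P measurableT; exact.
Qed.

(** The maps [z.1] and [X l z.2] are each measurable for the sigma-algebra generated by the
    cylinders, hence so is their pair. *)
Lemma measurable_cylinder (l : I) (C : set (R * R)) : l != k -> measurable C ->
  <<s cylinder >> [set z : R * T | C (z.1, X l z.2)].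
Proof.
move=> lk mC.
pose GT := g_sigma_algebraType cylinder.
have m1 : measurable_fun [set: GT] (fst : GT -> R).
  move=> _ A mA; rewrite setTI; apply: sub_sigma_algebra.
  exists A, (fun=> setT); split => //.
  by rewrite bigcapT// setXT.
have m2 : measurable_fun [set: GT] (fun z : GT => X l z.2).
  move=> _ A mA; rewrite setTI; apply: sub_sigma_algebra.
  exists setT, (fun i => if i == l then A else setT); split => //.
    by move=> i; case: ifP.
  apply/seteqP; split => -[x w] /=.
    by move=> Aw; split => // i ik; case: eqP => // ->.
  by move=> [_ /(_ l)]/=; rewrite eqxx; apply.
have := measurable_fun_pair m1 m2.
by move=> /(_ measurableT C mC); rewrite setTI.
Qed.

End disintegration.

(** * Order statistics through counts and ranks *)

Lemma count_enum (I : finType) (p : pred I) : count p (enum I) = #|p|.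
Proof. by rewrite cardE -size_filter enumT. Qed.

(** In the sorted list, the entry at position j - 1 exceeds t exactly when at most j - 1 of the n
    values are at most t; the right-hand side is the complementary count. *)
Lemma order_stat_gt d (T : measurableType d) (R : realType) n
    (X : 'I_n -> {mfun T >-> R}) (j : nat) (w : T) (t : R) :
  (1 <= j <= n)%N ->
  (t < order_stat X j w) = (n - j < count (fun k => (t < X k w)%R) (enum 'I_n))%N.
Proof.
move=> /andP[j1 jn]; rewrite /order_stat; set s := sort _ _.
have ss : sorted <=%O s by exact: (sort_sorted le_total).
have szs : size s = n by rewrite size_sort size_map size_enum_ord.
have cs a : count a s = count (fun k => a (X k w)) (enum 'I_n).
  by rewrite /s (permP (permEl (perm_sort _ _))) count_map.
have := count_predC (fun z => z <= t) s.
rewrite szs !cs [X in (_ + X)%N](eq_count (a2 := fun k : 'I_n => t < X k w)); last first.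
  by move=> k /=; rewrite -ltNge.
move=> cC; have [c|c] := leqP (count (fun z => z <= t) s) j.-1.
  rewrite nth_count_gt ?szs//; last by rewrite c prednK.
  by apply/esym; rewrite cs in c; lia.
rewrite ltNge nth_count_le//=.
by apply/esym/negbTE; rewrite cs in c; lia.
Qed.

Section precedes.
Context {R : realDomainType} {n : nat}.
Implicit Type x : 'I_n -> R.

Definition precedes x : rel 'I_n :=
  [rel l k | (x l < x k) || ((x l == x k) && (l < k)%N)].

Definition rank x k := count (precedes x ^~ k) (enum 'I_n).

Lemma precedes_irr x k : precedes x k k = false.
Proof. by rewrite /precedes/= ltxx ltnn andbF. Qed.

Lemma precedes_trans x : transitive (precedes x).
Proof.
move=> b a c /orP[ab|/andP[/eqP ab ab']] /orP[bc|/andP[/eqP bc bc']]; apply/orP.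
- by left; exact: lt_trans bc.
- by left; rewrite -bc.
- by left; rewrite ab.
- by right; rewrite ab bc eqxx/= (ltn_trans ab').
Qed.

Lemma precedes_total x l k : l != k -> precedes x l k || precedes x k l.
Proof.
rewrite -val_eqE neq_ltn /precedes /=.
by case: (ltgtP (x l) (x k)).
Qed.


Lemma rankE x k : rank x k = #|[pred l | precedes x l k]|.
Proof. exact: count_enum. Qed.

Lemma rank_lt x l k : precedes x l k -> (rank x l < rank x k)%N.
Proof.
move=> lk; rewrite !rankE; apply: proper_card; apply/properP; split.
  by apply/fintype.subsetP => z; rewrite !inE => zl; exact: precedes_trans lk.
by exists l; rewrite !inE// precedes_irr.
Qed.

Lemma rank_inj x : injective (rank x).
Proof.
move=> l k lk; apply/eqP; apply: contraT => /(precedes_total x).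
by move=> /orP[] /rank_lt; rewrite lk ltnn.
Qed.

Lemma rank_ltn x k : (rank x k < n)%N.
Proof.
rewrite rankE -[ltnRHS]card_ord -(cardC [pred l | precedes x l k]).
rewrite -[ltnLHS]addn0 ltn_add2l; apply/card_gt0P; exists k.
by rewrite !inE precedes_irr.
Qed.

(** The rank is an injective map of an n-element set into the numbers below n, hence a bijection. *)
Lemma rank_surj x m : (m < n)%N -> exists k, rank x k = m.
Proof.
move=> mn; pose f k := Ordinal (rank_ltn x k).
have f_inj : injective f by move=> l k /(congr1 val)/rank_inj.
by exists (invF f_inj (Ordinal mn)); have /(congr1 val) := f_invF f_inj (Ordinal mn).
Qed.

End precedes.

Section order_stat_rank.
Context d (T : measurableType d) (R : realType) (n : nat).
Variables (X : 'I_n -> {mfun T >-> R}).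

Let x w l := X l w.

(** The indices with value strictly below [X k w] all precede [k], while [k] and those that precede
    it have value at most [X k w]. Hence position [rank] of the sorted list falls in the block of
    entries equal to [X k w], even with ties. *)
Lemma rank_order_stat i w k : (1 <= i)%N -> rank (x w) k = i.-1 ->
  order_stat X i w = X k w.
Proof.
move=> i1 rk; have := rank_ltn (x w) k; rewrite rk => im.
rewrite /order_stat; apply: nth_count_eq; first exact: (sort_sorted le_total).
rewrite !(permP (permEl (perm_sort _ _))) !(count_map (fun k => X k w)) -rk.
apply/andP; split.
  by rewrite /rank; apply: sub_count => l /= lk; rewrite /precedes/= /x lk.
have -> : (rank (x w) k).+1 = count (predU1 k (precedes (x w) ^~ k)) (enum 'I_n).
  have kk : k \notin precedes (x w) ^~ k by rewrite /in_mem/= precedes_irr.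
  by rewrite count_enum cardU1 kk add1n -count_enum.
apply: sub_count => l /= /orP[/eqP->//|]; rewrite /precedes /= /x.
by move=> /orP[/ltW->//|/andP[/eqP->]].
Qed.

End order_stat_rank.

(** * Rays: uniqueness of measures, and probabilities for laws without atoms *)

Lemma rays_measure_unique (R : realType)
    (m1 m2 : {measure set (measurableTypeR R) -> \bar R}) :
  (m1 setT < +oo)%E ->
  (forall y : R, m1 `]y, +oo[%classic = m2 `]y, +oo[%classic) ->
  forall A, measurable A -> m1 A = m2 A.
Proof.
move=> m1oo m12 A mA.
(* The open right rays are stable under intersection, generate the Borel sets and cover the line. *)
apply: (@measure_unique _ R (measurableTypeR R) (@RGenOInfty.G R)
  (fun n => `](- n%:R)%R, +oo[%classic)) => //.
- exact: RGenOInfty.measurableE.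
- move=> _ _ [y ->] [z ->]; exists (Num.max y z).
  by apply/seteqP; split => x /=; rewrite !in_itv/= !andbT gt_max => /andP.
- by move=> n; exists (- n%:R).
- apply/seteqP; split => // x _; exists (Num.truncn `|x|).+1 => //=.
  rewrite in_itv/= andbT ltrNl (le_lt_trans (ler_norm _))// normrN.
  exact: truncnS_gt.
- by move=> _ [y ->].
- by move=> n; apply: le_lt_trans m1oo; apply: le_measure; rewrite ?inE.
Qed.

Section no_atoms.
Context d (T : measurableType d) (R : realType) (P : probability T R).
Context (F : R -> R) (X : {RV P >-> R}).
Hypothesis XF : forall x, cdf X x = (F x)%:E.
Hypothesis X0 : forall x, P (X @^-1` [set x]) = 0%E.

Let mX C : measurable C -> measurable (X @^-1` C).
Proof. exact: measurable_funPTI. Qed.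

Lemma prob_gt x : P (X @^-1` `]x, +oo[) = (1 - F x)%:E.
Proof.
by rewrite EFinB -XF -(probability_setC (distribution P X))//= setCitvl.
Qed.

(** The flag [b] chooses between the open and the closed ray: breaking ties by the index requires
    both. *)
Lemma prob_lt (b : bool) x :
  P (X @^-1` [set` Interval -oo%O (BSide b x)]) = (F x)%:E.
Proof.
case: b; last by rewrite -XF.
rewrite -XF /cdf -(@setUitv1 _ _ -oo%O x true)// [RHS]measureU//; last first.
  by apply/seteqP; split => // z [/=]; rewrite in_itv/= => /[swap] ->; rewrite ltxx.
by rewrite [X in (_ + X)%E]X0 adde0.
Qed.

(** For negative y the second ray contains the first, whence the maximum. The two events can differ
    only where X = x, which has probability zero. Negative y matters because conditional laws are
    compared on all rays. *)
Lemma prob_max (b : bool) x y :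
  P (X @^-1` ([set` Interval (BSide b x) +oo%O] `&` `]x + y, +oo[)) =
  (1 - F (x + Num.max 0 y))%:E.
Proof.
have mS : measurable (X @^-1` ([set` Interval (BSide b x) +oo%O] `&` `]x + y, +oo[)).
  by apply: mX; exact: measurableI.
have mU : measurable (X @^-1` `]x + Num.max 0 y, +oo[) by exact: mX.
rewrite -prob_gt; apply/eqP; rewrite eq_le; apply/andP; split.
  rewrite -[leRHS]adde0 -(X0 x).
  apply: le_trans (measureU2 _ mU (mX (measurable_set1 x))).
  apply: le_measure; rewrite ?inE//; first by apply: measurableU => //; exact: mX.
  move=> w [/=]; rewrite !in_itv/= !andbT => bx yx.
  have [->|Xx] := eqVneq (X w) x; first by right.
  left; rewrite -ltrBrDl gt_max subr_gt0 ltrBrDl yx andbT.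
  by rewrite lt_neqAle eq_sym Xx/=; case: (b) bx => // /ltW.
apply: le_measure; rewrite ?inE// => w /=; rewrite !in_itv/= !andbT.
rewrite -ltrBrDl gt_max subr_gt0 ltrBrDl => /andP[xX yX]; split => //.
by case: (b) => //=; exact: ltW.
Qed.

End no_atoms.

Lemma itv_Nyo_bigcup (R : realType) (s : R) :
  `]-oo, s[%classic = \bigcup_n `]-oo, s - n.+1%:R^-1]%classic.
Proof.
apply/seteqP; split => [x|x [n _]]; rewrite /= !in_itv/=.
  by move=> /ltr_add_invr[n xns]; exists n => //=; rewrite in_itv/= lerBrDr ltW.
by move=> /le_lt_trans; apply; rewrite ltrBlDr ltrDl.
Qed.

Lemma nondecreasing_itv_Nyo (R : realType) (s : R) :
  nondecreasing_seq (fun n : nat => `]-oo, s - n.+1%:R^-1]%classic).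
Proof.
move=> a b ab; apply/subsetPset => x; rewrite /= !in_itv/= => /le_trans; apply.
by rewrite lerD2l lerN2 lef_pV2 ?posrE// ler_nat.
Qed.

(** * Distribution functions with a density, and the support of a DFR law *)

Section density.
Context d (T : measurableType d) (R : realType) (P : probability T R).
Context (X : {RV P >-> R}) (F : R -> R).
Hypothesis XF : forall x, cdf X x = (F x)%:E.

Lemma cdf_nondecr : {homo F : x y / x <= y}.
Proof. by move=> x y xy; rewrite -lee_fin -!XF cdf_nondecreasing. Qed.

Lemma cdf_itv01 x : 0 <= F x <= 1.
Proof. by rewrite -!lee_fin -XF cdf_ge0 cdf_le1. Qed.

Lemma measurable_cdf : measurable_fun [set: R] F.
Proof.
apply/measurable_EFinP; rewrite (_ : _ \o _ = cdf X).
  exact: cdf_measurable.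
by apply/funext => x; rewrite XF.
Qed.

(** The mass of []-oo, x[] is the limit of F (x - 1/(n+1)). Written as integrals of [f], these
    values converge to F x, since Lebesgue measure does not charge x; nothing is left for the point
    x. *)
Lemma density_no_atom f : is_density F f -> forall x, P (X @^-1` [set x]) = 0%E.
Proof.
move=> [mf f0 Ff] x.
have mfE D : measurable_fun D (EFin \o f).
  by apply: measurable_funTS; exact/measurable_EFinP.
have e : distribution P X `]-oo, x[ = (F x)%:E.
  have h1 : distribution P X `]-oo, x - n.+1%:R^-1] @[n --> \oo] -->
      distribution P X `]-oo, x[.
    rewrite itv_Nyo_bigcup; apply: nondecreasing_cvg_mu => //.
      by apply: bigcupT_measurable.
    exact: nondecreasing_itv_Nyo.
  have h2 : distribution P X `]-oo, x - n.+1%:R^-1] @[n --> \oo] --> (F x)%:E.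
    rewrite [X in X @ _ --> _](_ : _ = (fun n : nat =>
      \int[lebesgue_measure]_(t in `]-oo, (x - n.+1%:R^-1)%R]) (f t)%:E)%E); last first.
      by apply/funext => n; rewrite -Ff -XF.
    rewrite Ff -integral_itv_bndo_bndc; last exact: mfE.
    rewrite itv_Nyo_bigcup; apply: ge0_nondecreasing_set_cvg_integral => //.
    - exact: nondecreasing_itv_Nyo.
    - by move=> n; exact: mfE.
    - by move=> n t _; rewrite lee_fin.
  exact: (cvg_unique _ h1).
have mx : measurable (X @^-1` [set x]).
  exact: measurable_funPTI.
have : ((F x)%:E = distribution P X `]-oo, x[ + P (X @^-1` [set x]))%E.
  rewrite -XF /cdf -(@setUitv1 _ _ -oo%O x true)// [LHS]measureU//.
  by apply/seteqP; split => // z [/=]; rewrite in_itv/= => /[swap] ->; rewrite ltxx.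
have fx : P (X @^-1` [set x]) \is a fin_num by exact: fin_num_measure.
rewrite e -(fineK fx) -EFinD => -[Fx]; congr (_%:E); lra.
Qed.

(** A law without atoms has a left-continuous distribution function. *)
Lemma cdf_left_le x c : (forall y, y < x -> F y <= c) ->
  (forall x, P (X @^-1` [set x]) = 0%E) -> F x <= c.
Proof.
move=> Fc X0.
have h1 : distribution P X `]-oo, x - n.+1%:R^-1] @[n --> \oo] --> (F x)%:E.
  rewrite -(prob_lt XF X0 true) -[P _]/(distribution P X _).
  rewrite itv_Nyo_bigcup; apply: nondecreasing_cvg_mu => //.
    by apply: bigcupT_measurable.
  exact: nondecreasing_itv_Nyo.
rewrite -lee_fin -(cvg_lim _ h1)//; apply: lime_le.
  by apply/cvg_ex; exists (F x)%:E.
apply: nearW => n.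
by rewrite -[leLHS]/(cdf X _) XF lee_fin Fc// ltrBlDr ltrDl.
Qed.

(** Take the last point at which F does not exceed F a. It exists by left-continuity, and F
    increases immediately to its right, so it is a point of increase. *)
Lemma support_above a b : (forall x, P (X @^-1` [set x]) = 0%E) ->
  F a < 1 -> F b = 1 ->
  exists x, [/\ a <= x, x < b, cdf_support F x & F x <= F a].
Proof.
move=> X0 Fa Fb; pose S := [set x | F x <= F a].
have Sb : ubound S b.
  move=> x /= Fx; rewrite leNgt; apply/negP => bx.
  have := cdf_nondecr (ltW bx); rewrite Fb => F1.
  by have := le_lt_trans (le_trans F1 Fx) Fa; rewrite ltxx.
have hS : has_sup S by split; [exists a; exact: lexx|exists b].
have FS : F (sup S) <= F a.
  apply: cdf_left_le => // y /(sup_gt hS.1)[z /= Fz yz].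
  exact: le_trans (cdf_nondecr (ltW yz)) Fz.
exists (sup S); split => //.
- by apply: (sup_upper_bound hS); exact: lexx.
- rewrite lt_neqAle ge_sup ?andbT//; last exact: hS.1.
  by apply: contraTneq Fa => sb; rewrite -leNgt -Fb -sb.
move=> e e0; apply: (@le_lt_trans _ _ (F a)).
  by apply: le_trans FS; apply: cdf_nondecr; rewrite gerBl ltW.
rewrite ltNge; apply/negP => h.
have : sup S + e <= sup S by exact: (sup_upper_bound hS).
by rewrite gerDl leNgt e0.
Qed.

(** If F b = 1 at a support point b, then F < 1 to the left of b. For support points x1 < x2 < b and
    y = b - x2, the survival ratio vanishes at x2 but not at x1, since x1 + y < b; this contradicts
    DFR. *)
Lemma DFR_survival_gt0 f : DFR F -> is_density F f ->
  forall x, cdf_support F x -> 0 < survival F x.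
Proof.
move=> dfr /density_no_atom X0 b Sb; rewrite /survival subr_gt0 ltNge.
apply/negP => Fb1.
have Fb : F b = 1 by apply/le_anti; rewrite Fb1 andbT; have /andP[] := cdf_itv01 b.
have lt1 a : a < b -> F a < 1.
  move=> ab; have := Sb (b - a); rewrite subr_gt0 => /(_ ab).
  rewrite subKr => /lt_le_trans; apply.
  by have /andP[] := cdf_itv01 (b + (b - a)).
(* Starting the search for [x2] at the midpoint of x1 and b forces x1 < x2. *)
have [x1 [_ x1b Sx1 _]] := support_above X0 (lt1 (b - 1) (ltac:(by rewrite ltrBlDr ltrDl))) Fb.
have [x2 [mx2 x2b Sx2 _]] := support_above X0 (lt1 ((x1 + b) / 2) (ltac:(by lra))) Fb.
have x12 : x1 < x2 by apply: lt_le_trans mx2; lra.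
have s1 : 0 < survival F x1 by rewrite subr_gt0 lt1.
have s2 : 0 < survival F x2 by rewrite subr_gt0 lt1.
have y0 : 0 <= b - x2 by rewrite subr_ge0 ltW.
have := dfr _ y0 x1 x2 (mem_set (conj Sx1 s1)) (mem_set (conj Sx2 s2)) (ltW x12).
rewrite subrKC {2 3}/survival Fb subrr mul0r pmulr_lle0 ?invr_gt0// subr_le0.
by apply/negP; rewrite -ltNge lt1//; lra.
Qed.

End density.

(** * The event that a given index has a given rank, and its probability *)

Lemma measurable_pair_lray (R : realType) (b : bool) :
  measurable [set z : R * R | [set` Interval -oo%O (BSide b z.1)] z.2].
Proof.
rewrite -[X in measurable X]setTI.
case: b => /=.
  rewrite (_ : [set z | _] = (fun z : R * R => z.2 < z.1) @^-1` [set true]).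
    exact: (measurable_fun_ltr measurable_snd measurable_fst).
  by apply/seteqP; split => z; rewrite /= in_itv.
rewrite (_ : [set z | _] = (fun z : R * R => z.2 <= z.1) @^-1` [set true]).
  exact: (measurable_fun_ler measurable_snd measurable_fst).
by apply/seteqP; split => z; rewrite /= in_itv.
Qed.

Lemma measurable_pair_rray (R : realType) (b : bool) (y : R) :
  measurable [set z : R * R |
    ([set` Interval (BSide b z.1) +oo%O] `&` `]z.1 + y, +oo[) z.2].
Proof.
rewrite (_ : [set z | _] =
    ~` [set z : R * R | [set` Interval -oo%O (BSide b z.1)] z.2] `&`
    (fun z : R * R => z.1 + y < z.2) @^-1` [set true]).
  apply: measurableI; first by apply: measurableC; exact: measurable_pair_lray.
  rewrite -[X in measurable X]setTI; apply: measurable_fun_ltr => //.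
  exact: measurable_funD.
apply/seteqP; split => z /=; rewrite !in_itv/= !andbT; case: b => /= -[h ?]; split => //.
- by rewrite ltNge h.
- by rewrite leNgt h.
- by rewrite leNgt; apply/negP.
- by rewrite ltNge; apply/negP.
Qed.

Section rays.
Context d (T : measurableType d) (R : realType) (P : probability T R).
Context (I : finType) (X : I -> {RV P >-> R}) (F : R -> R).
Hypothesis indX : mutually_independent P X.
Hypothesis XF : forall l x, cdf (X l) x = (F x)%:E.
Hypothesis X0 : forall l x, P (X l @^-1` [set x]) = 0%E.

Lemma lray_rrayI (b : bool) (x : R) (A : set R) :
  [set` Interval -oo%O (BSide b x)] `&` ([set` Interval (BSide b x) +oo%O] `&` A) = set0.
Proof.
apply/seteqP; split => // u [/=]; rewrite in_itv/= => ux [].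
rewrite in_itv/= andbT; case: b ux => /= ux; first by rewrite leNgt ux.
by rewrite ltNge ux.
Qed.

(** The side [b l] of the boundary point varies with the index, but without atoms all trials have
    the same three probabilities, the last one being the remaining mass. *)
Lemma prob_countset_rays (b : I -> bool) (s : seq I) (x y : R) a r : uniq s ->
  P (countset (fun l => X l @^-1` [set` Interval -oo%O (BSide (b l) x)])
    (fun l => X l @^-1` ([set` Interval (BSide (b l) x) +oo%O] `&` `]x + y, +oo[))
    s a r) =
  (count_prob (F x) (1 - F (x + Num.max 0 y)) (F (x + Num.max 0 y) - F x)
     (size s) a r)%:E.
Proof.
move=> us; rewrite -[X in P X]setTI.
have -> : [set: T] = \bigcap_(l in [set` (finset.set0 : {set I})]) (X l @^-1` setT).
  by rewrite bigcapT// => l _; rewrite preimage_setT.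
have mV l : measurable ([set` Interval (BSide (b l) x) +oo%O] `&` `]x + y, +oo[).
  exact: measurableI.
rewrite (prob_countset (b := F x) (p := 1 - F (x + Num.max 0 y))
  (q := F (x + Num.max 0 y) - F x)
  (B := fun l => [set` Interval -oo%O (BSide (b l) x)])
  (V := fun l => [set` Interval (BSide (b l) x) +oo%O] `&` `]x + y, +oo[))//.
- by rewrite big_set0 mul1e.
- by move=> l; exact: lray_rrayI.
- by move=> l ls; exact: prob_lt.
- by move=> l ls; exact: prob_max.
- move=> l ls; rewrite -preimage_setC probability_setC; last first.
    by apply: measurable_funPTI; exact: measurableU.
  rewrite preimage_setU measureU//; last 3 first.
  + exact: measurable_funPTI.
  + exact: measurable_funPTI.
  + by rewrite -preimage_setI lray_rrayI preimage_set0.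
  transitivity (1 - ((F x)%:E + (1 - F (x + Num.max 0 y))%:E))%E.
    by congr (1 - (_ + _))%E; [exact: prob_lt|exact: prob_max].
  by rewrite -EFinD; congr (_%:E); ring.
- by move=> l _; rewrite inE.
Qed.

End rays.

Section rank_event.
Context d (T : measurableType d) (R : realType) (P : probability T R) (n : nat).
Context (X : 'I_n -> {RV P >-> R}) (F : R -> R).
Hypothesis indX : mutually_independent P X.
Hypothesis XF : forall l x, cdf (X l) x = (F x)%:E.
Hypothesis X0 : forall l x, P (X l @^-1` [set x]) = 0%E.

Definition others (k : 'I_n) := [seq l <- enum 'I_n | l != k].

(** The first coordinate stands for the value of [X k], decoupled from the sample so that it can be
    frozen. The left ray is closed for l < k and open otherwise, in accordance with [precedes]. *)
Definition rank_event (y : R) (m r : nat) (k : 'I_n) : set (R * T) :=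
  countset
    (fun l : 'I_n => [set z : R * T |
      [set` Interval -oo%O (BSide (~~ (l < k)%N) z.1)] (X l z.2)])
    (fun l : 'I_n => [set z : R * T | ([set` Interval (BSide (~~ (l < k)%N) z.1) +oo%O] `&`
                        `]z.1 + y, +oo[) (X l z.2)])
    (others k) m r.

Lemma size_others k : size (others k) = n.-1.
Proof.
rewrite size_filter count_enum -[in RHS](card_ord n) -(cardC1 k).
by apply: eq_card => l; rewrite !inE.
Qed.

Lemma uniq_others k : uniq (others k).
Proof. exact: filter_uniq (enum_uniq _). Qed.

Lemma rank_event_cylinder y m r k : <<s cylinder X k >> (rank_event y m r k).
Proof.
apply: (@measurable_countset 'I_n _ (g_sigma_algebraType (cylinder X k))).
- move=> l; apply/seteqP; split => // z [h1 h2].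
  have : set0 (X l z.2) by rewrite -(lray_rrayI (~~ (l < k)%N) z.1 `]z.1 + y, +oo[).
  by [].
- move=> l; rewrite mem_filter => /andP[lk _].
  exact: (measurable_cylinder (X := X) lk (measurable_pair_lray (~~ (l < k)%N))).
- move=> l; rewrite mem_filter => /andP[lk _].
  exact: (measurable_cylinder (X := X) lk (measurable_pair_rray (~~ (l < k)%N) y)).
Qed.

(** By disintegration [X k] is frozen at x, and each section is a count over the n - 1 other
    observations. *)
Lemma prob_rank_event y m r k A : measurable A ->
  P [set w | A (X k w) /\ rank_event y m r k (X k w, w)] =
  (\int[distribution P (X k)]_(x in A)
   (count_prob (F x) (1 - F (x + Num.max 0 y)) (F (x + Num.max 0 y) - F x)
     n.-1 m r)%:E)%E.
Proof.
move=> mA.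
have := @independent_disintegration _ _ _ _ _ X k
  ([set z | A z.1] `&` rank_event y m r k) indX.
move=> ->; last first.
  apply: (@measurableI _ (g_sigma_algebraType (cylinder X k))); last first.
    exact: rank_event_cylinder.
  apply: sub_sigma_algebra; exists A, (fun=> setT); split => //.
  by rewrite bigcapT// setXT.
rewrite [RHS]integral_mkcond; apply: eq_integral => x _.
rewrite patchE -(size_others k); case: ifPn => xA.
  rewrite -(prob_countset_rays indX XF X0 (fun l => ~~ (l < k)%N)) ?uniq_others//.
  congr (P _); rewrite xsectionE; apply/seteqP; split => [w []//|w xw].
  by split => //; exact: set_mem xA.
rewrite (_ : xsection _ _ = set0) ?measure0//.
by apply/seteqP; split => // w /xsectionP[/=]; rewrite notin_setE in xA.
Qed.

End rank_event.

Lemma measurable_count_prob d (T : measurableType d) (R : realType)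
    (b p q : T -> R) n a r :
  measurable_fun [set: T] b -> measurable_fun [set: T] p ->
  measurable_fun [set: T] q ->
  measurable_fun [set: T] (fun x => count_prob (b x) (p x) (q x) n a r).
Proof.
move=> mb mp mq; elim: n a r => [|n IH] a r /=; first exact: measurable_cst.
apply: measurable_funD; last by apply: measurable_funM.
apply: measurable_funD; last by apply: measurable_funM.
by case: a => [|a]; [exact: measurable_cst|exact: measurable_funM].
Qed.

(** * The law of an order statistic and its joint law with a gap *)

Section order_stat_law.
Context d (T : measurableType d) (R : realType) (P : probability T R) (n : nat).
Context (X : 'I_n -> {RV P >-> R}) (F : R -> R).
Hypothesis indX : mutually_independent P X.
Hypothesis XF : forall l x, cdf (X l) x = (F x)%:E.
Hypothesis X0 : forall l x, P (X l @^-1` [set x]) = 0%E.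

Let rk (w : T) (k : 'I_n) := rank (fun l => X l w) k.

Lemma measurable_rank m k : measurable [set w | rk w k = m].
Proof.
rewrite (_ : [set w | _] = countset
    (fun l => [set w | precedes (fun l => X l w) l k]) (fun=> set0) (enum 'I_n) m 0).
  apply: measurable_countset => // [l|l _]; first by rewrite setI0.
  rewrite -[X in measurable X]setTI; have [lk|kl] := boolP (l < k)%N.
    rewrite (_ : [set w | _] = (fun w => X l w <= X k w) @^-1` [set true]).
      by apply: (measurable_fun_ler (measurable_funPT (X l)) (measurable_funPT (X k))).
    by apply/seteqP; split => w /=; rewrite /precedes /= lk andbT le_eqVlt orbC.
  rewrite (_ : [set w | _] = (fun w => X l w < X k w) @^-1` [set true]).
    by apply: (measurable_fun_ltr (measurable_funPT (X l)) (measurable_funPT (X k))).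
  by apply/seteqP; split => w /=; rewrite /precedes /= (negbTE kl) andbF orbF.
have e w : rk w k = count (fun l => w \in [set w | precedes (fun l => X l w) l k]) (enum 'I_n).
  by apply: eq_count => l /=; rewrite mem_setE.
by apply/seteqP; split => w; rewrite /countset /= e; [move=> ->|case].
Qed.

(** Exactly one index has rank [m], so these events partition the space. *)
Lemma prob_rank E m : (m < n)%N -> measurable E ->
  P E = (\sum_(k < n) P (E `&` [set w | rk w k = m]))%E.
Proof.
move=> mn mE.
have {1}-> : E = \big[setU/set0]_(k < n) (E `&` [set w | rk w k = m]).
  rewrite -bigcup_seq; apply/seteqP; split => [w Ew|w [k _ []//]].
  have [k km] := rank_surj (fun l => X l w) mn.
  by exists k => //=; exact: mem_index_enum.
rewrite measure_bigsetU_ord//.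
  by move=> k; apply: measurableI => //; exact: measurable_rank.
move=> k l _ _ [w [[_ /= km] [_ /= lm]]].
by apply: (rank_inj (x := fun l => X l w)); rewrite -/(rk w k) -/(rk w l) km lm.
Qed.

Lemma mem_lray w (l k : 'I_n) :
  ((X k w, w) \in [set z : R * T | [set` Interval -oo%O (BSide (~~ (l < k)%N) z.1)] (X l z.2)])
  = precedes (fun l => X l w) l k.
Proof.
transitivity (X l w \in Interval -oo%O (BSide (~~ (l < k)%N) (X k w))).
  by apply/idP/idP => [/set_mem//|h]; exact/mem_set.
rewrite in_itv /precedes /=.
by case: (l < k)%N => /=; rewrite ?andbF ?andbT ?orbF// le_eqVlt orbC.
Qed.

Lemma mem_rray y w (l k : 'I_n) :
  ((X k w, w) \in [set z : R * T | ([set` Interval (BSide (~~ (l < k)%N) z.1) +oo%O] `&`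
                        `]z.1 + y, +oo[) (X l z.2)])
  = ~~ precedes (fun l => X l w) l k && (X k w + y < X l w).
Proof.
apply/idP/idP.
  move=> /set_mem[/=]; rewrite !in_itv/= !andbT => h ->; rewrite andbT.
  move: h; rewrite /precedes/=; case: (l < k)%N => /=.
    by rewrite andbT orbC -le_eqVlt ltNge.
  by rewrite andbF orbF leNgt.
move=> /andP[h ?]; apply/mem_set; split; rewrite /= in_itv/= andbT//.
move: h; rewrite /precedes/=; case: (l < k)%N => /=.
  by rewrite andbT orbC -le_eqVlt ltNge.
by rewrite andbF orbF leNgt.
Qed.

Lemma rank_eventE y m r w k : rank_event X y m r k (X k w, w) <->
  rk w k = m /\ (r <= count (fun l =>
    ~~ precedes (fun l => X l w) l k && (X k w + y < X l w)%R) (others k))%N.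
Proof.
rewrite /rank_event /countset /=.
rewrite (eq_count (a2 := precedes (fun l => X l w) ^~ k)); last first.
  by move=> l; exact: mem_lray.
rewrite [X in (_ <= X)%N](eq_count (a2 := fun l => ~~ precedes (fun l => X l w) l k &&
    (X k w + y < X l w))); last first.
  by move=> l; exact: mem_rray.
suff -> : rk w k = count (precedes (fun l => X l w) ^~ k) (others k) by [].
rewrite /rk /rank /others [RHS]count_filter; apply: eq_count => l /=.
by case: eqVneq => [->|]; rewrite ?andbT// precedes_irr.
Qed.

Lemma order_stat_gap_rank i j y w k : (1 <= i)%N -> (i < j)%N -> (j <= n)%N ->
  rk w k = i.-1 ->
  (y < order_stat X j w - order_stat X i w) =
  (n - j < count (fun l =>
    ~~ precedes (fun l => X l w) l k && (X k w + y < X l w)%R) (others k))%N.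
Proof.
move=> i1 ij jn rki; rewrite (rank_order_stat i1 rki) ltrBrDl order_stat_gt; last first.
  by rewrite jn andbT; lia.
rewrite /others [X in _ = (_ < X)%N]count_filter.
have [y0|y0] := leP 0 y.
  congr (_ < _)%N; apply: eq_count => l /=.
  have [Xl|] := ltP (X k w + y) (X l w); last by rewrite andbF.
  have kl : X k w < X l w by apply: le_lt_trans Xl; rewrite lerDl.
  rewrite /precedes /= ltNge (ltW kl)/= gt_eqF//=.
  by apply/esym; apply: contraTneq kl => ->; rewrite ltxx.
(* For negative y both sides are true. The n - i + 1 indices that do not precede [k] all have values
   above X_k + y; discarding [k] itself leaves n - i of them, which is still more than n - j. *)
have cP : (count (predC (precedes (fun l => X l w) ^~ k)) (enum 'I_n) = n - i.-1)%N.
  have := count_predC (precedes (fun l => X l w) ^~ k) (enum 'I_n).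
  by rewrite size_enum_ord -/(rank _ k) -/(rk w k) rki; lia.
have notP l : ~~ precedes (fun l => X l w) l k -> X k w + y < X l w.
  rewrite /precedes /= negb_or -leNgt => /andP[kl _].
  by apply: lt_le_trans kl; rewrite gtrDl.
transitivity true.
  apply: (@leq_trans (n - i.-1)); first by lia.
  by rewrite -cP; apply: sub_count => l /= /notP.
apply/esym; apply: (@leq_trans (n - i)); first by lia.
rewrite -ltnS; apply: (@leq_trans (n - i.-1)); first by lia.
rewrite -cP !count_enum (cardD1 k) -addn1 addnC leq_add ?leq_b1//.
apply: subset_leq_card; apply/fintype.subsetP => l; rewrite !inE => /andP[lk kl].
by rewrite lk kl notP.
Qed.

Lemma integral_distribution_eq (k l : 'I_n) A (f : R -> \bar R) : measurable A ->
  (\int[distribution P (X k)]_(x in A) f x =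
   \int[distribution P (X l)]_(x in A) f x)%E.
Proof.
move=> mA; apply: eq_measure_integral => B mB _.
rewrite -[LHS]/(@pushforward _ _ T (measurableTypeR R) R P (X k) B).
rewrite -[RHS]/(@pushforward _ _ T (measurableTypeR R) R P (X l) B).
apply: rays_measure_unique => //.
- exact: (measurable_funPT (X k)).
- exact: (measurable_funPT (X l)).
- move=> mXk; apply: (@le_lt_trans _ _ 1%E); last exact: ltry.
  by have := probability_le1 P measurableT; exact.
- by move=> ? ? y; exact: etrans (prob_gt (XF k) y) (esym (prob_gt (XF l) y)).
Qed.

(** Splitting [E] by the index of rank i - 1 gives n equal integrals, and [count_prob_binomial]
    extracts the power of F. The choice of [r] yields both the law of X_(i) and its joint law with
    the gap. *)
Lemma prob_order_stat_rank (k0 : 'I_n) i y r E A : (1 <= i <= n)%N ->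
  measurable E -> measurable A ->
  (forall w k, rk w k = i.-1 -> E w <-> A (X k w) /\
   (r <= count (fun l =>
    ~~ precedes (fun l => X l w) l k && (X k w + y < X l w)%R) (others k))%N) ->
  P E = (\int[distribution P (X k0)]_(x in A)
    (n%:R * 'C(n.-1, i.-1)%:R * F x ^+ i.-1 *
     count_prob (F x) (1 - F (x + Num.max 0 y)) (F (x + Num.max 0 y) - F x)
       (n - i) 0 r)%:E)%E.
Proof.
move=> /andP[i1 ilen] mE mA EE.
have mF := measurable_cdf (XF k0).
have mFy : measurable_fun [set: R] (fun x => F (x + Num.max 0 y)).
  by apply: measurableT_comp => //; exact: measurable_funD.
pose cp x := count_prob (F x) (1 - F (x + Num.max 0 y))
  (F (x + Num.max 0 y) - F x) n.-1 i.-1 r.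
have F01 := cdf_itv01 (XF k0).
have cp0 x : 0 <= cp x.
  have Fle : F x <= F (x + Num.max 0 y).
    by apply: (cdf_nondecr (XF k0)); rewrite lerDl le_max lexx.
  have /andP[? ?] := F01 x; have /andP[? ?] := F01 (x + Num.max 0 y).
  by apply: count_prob_ge0 => //; rewrite subr_ge0.
have mcp : measurable_fun [set: R] cp.
  apply: measurable_count_prob => //; last exact: measurable_funB.
  exact: measurable_funB.
rewrite (@prob_rank _ i.-1)//; last by rewrite prednK.
transitivity (\sum_(k < n) \int[distribution P (X k0)]_(x in A) (cp x)%:E)%E.
  apply: eq_bigr => k _; rewrite (integral_distribution_eq k0 k)//.
  rewrite -(prob_rank_event indX XF X0)//; congr (P _).
  apply/seteqP; split => w /=.
    by move=> [Ew rw]; have /(EE _ _ rw)[] := Ew; rewrite rank_eventE.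
  by rewrite rank_eventE => -[Aw [rw cw]]; split => //; apply/(EE _ _ rw).
rewrite -ge0_integral_sum//.
- apply: eq_integral => x _; rewrite sumEFin sumr_const card_ord -[X in X%:E = _]mulr_natl.
  rewrite /cp count_prob_binomial (_ : (n.-1 - i.-1 = n - i)%N); last by lia.
  by rewrite !mulrA.
- by move=> _; apply: measurable_funTS; exact/measurable_EFinP.
- by move=> _ x _; rewrite lee_fin.
Qed.

Lemma prob_order_stat (k0 : 'I_n) i A : (1 <= i <= n)%N -> measurable A ->
  distribution P (order_stat X i) A = (\int[distribution P (X k0)]_(x in A)
    (n%:R * 'C(n.-1, i.-1)%:R * F x ^+ i.-1 * (1 - F x) ^+ (n - i))%:E)%E.
Proof.
move=> i1n mA; rewrite /distribution /pushforward.
(* With r = 0 nothing is required above x, and the tail sums to (1 - F x)^(n - i). *)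
rewrite (@prob_order_stat_rank k0 i 0 0 _ A)//.
- apply: eq_integral => x _; rewrite count_prob0 maxxx addr0.
  by congr ((_ * _ ^+ _)%:E); ring.
- exact: measurable_funPTI.
- move=> w k rw; rewrite /= (@rank_order_stat _ _ _ _ X i w k)//; last by case/andP: i1n.
  by split => // -[].
Qed.

Lemma prob_order_stat_gap (k0 : 'I_n) i j y A : (1 <= i)%N -> (i < j)%N -> (j <= n)%N ->
  measurable A ->
  P (order_stat X i @^-1` A `&` (order_stat X j \- order_stat X i) @^-1` `]y, +oo[) =
  (\int[distribution P (X k0)]_(x in A)
    (n%:R * 'C(n.-1, i.-1)%:R * F x ^+ i.-1 *
     count_prob (F x) (1 - F (x + Num.max 0 y)) (F (x + Num.max 0 y) - F x)
       (n - i) 0 (n - j).+1)%:E)%E.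
Proof.
move=> i1 ij jn mA; apply: prob_order_stat_rank => //.
- by rewrite i1 (leq_trans _ jn)// ltnW.
- by apply: measurableI; exact: measurable_funPTI.
- move=> w k rw; rewrite /= in_itv/= andbT (order_stat_gap_rank y i1 ij jn rw).
  by rewrite (@rank_order_stat _ _ _ _ X i w k).
Qed.

End order_stat_law.

(** * The conditional law of the gap as a kernel *)

Section gap_kernel.
Context d (T : measurableType d) (R : realType) (P : probability T R) (m : nat).
Context (X : 'I_m -> {RV P >-> R}) (Z : {RV P >-> R}).

Definition exceed (x : R) : set T := [set w | forall l, x < X l w].

Lemma measurable_exceed x : measurable (exceed x).
Proof.
rewrite (_ : exceed x = \bigcap_(l in [set: 'I_m]) (X l @^-1` `]x, +oo[)).
  apply: fin_bigcap_measurable => // l _.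
  exact: measurable_funPTI.
apply/seteqP; split => w /= H l.
  by move=> _; rewrite /= in_itv/= H.
by have := H l Logic.I; rewrite /= in_itv/= andbT.
Qed.

(** An unnormalised conditional law of Z - x given that all the observations exceed x. Normalising
    it afterwards gives one probability kernel that serves all y at once. *)
Definition gap_measure (x : R) (B : set (measurableTypeR R)) : \bar R :=
  P (exceed x `&` (fun w => Z w - x) @^-1` B).

Let measurable_gap x B : measurable B ->
  measurable (exceed x `&` (fun w => Z w - x) @^-1` B).
Proof.
move=> mB; apply: measurableI; first exact: measurable_exceed.
rewrite -[X in measurable X]setTI.
exact: measurable_funB.
Qed.

Let gap_measure0 x : gap_measure x set0 = 0%E.
Proof. by rewrite /gap_measure preimage_set0 setI0 measure0. Qed.

Let gap_measure_ge0 x B : (0 <= gap_measure x B)%E.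
Proof. exact: measure_ge0. Qed.

Let gap_measure_sigma_additive x : semi_sigma_additive (gap_measure x).
Proof.
move=> B mB tB mUB; rewrite /gap_measure preimage_bigcup setI_bigcupr.
apply: measure_semi_sigma_additive.
- by move=> n; apply: measurable_gap; exact: mB.
- by move=> a b _ _ [w [[_ wa] [_ wb]]]; apply: tB => //; exists (Z w - x).
- by rewrite -setI_bigcupr -preimage_bigcup; exact: measurable_gap.
Qed.

HB.instance Definition _ x := isMeasure.Build _ _ _ (gap_measure x)
  (gap_measure0 x) (gap_measure_ge0 x) (@gap_measure_sigma_additive x).

Definition gap_kernel (x : measurableTypeR R) :
  {measure set (measurableTypeR R) -> \bar R} := gap_measure x.

Let measurable_gap_kernel B : measurable B ->
  measurable_fun [set: measurableTypeR R] (gap_kernel ^~ B).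
Proof.
move=> mB.
(* The measure of [B] at x is the probability of the x-section of one measurable set, hence
   measurable in x. *)
pose E := [set z : R * T | exceed z.1 z.2 /\ B (Z z.2 - z.1)].
rewrite (_ : gap_kernel ^~ B = P \o xsection E).
  apply: measurable_fun_xsection.
  rewrite (_ : E = \bigcap_(l in [set: 'I_m])
      ((fun z : R * T => z.1 < X l z.2) @^-1` [set true]) `&`
      (fun z : R * T => Z z.2 - z.1) @^-1` B).
    apply: measurableI.
      apply: fin_bigcap_measurable => // l _.
      rewrite -[X in measurable X]setTI; apply: measurable_fun_ltr => //.
      by apply: measurableT_comp.
    rewrite -[X in measurable X]setTI; apply: measurable_funB => //.
    by apply: measurableT_comp.
  apply/seteqP; split => z /= [H BZ]; split => // l; first by move=> _; exact: H.
  exact: H.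
by apply/funext => x; rewrite /= xsectionE.
Qed.

HB.instance Definition _ :=
  isKernel.Build _ _ _ _ R gap_kernel measurable_gap_kernel.

End gap_kernel.

Section integral_kernel.
Context d d' (T : measurableType d) (T' : measurableType d') (R : realType).
Context (nu : {measure set T -> \bar R}) (A : set T) (mA : measurable A).
Context (kappa : T -> {measure set T' -> \bar R}).
Hypothesis mkappa : forall B, measurable B -> measurable_fun [set: T] (kappa ^~ B).

(** This mixture is made a measure in [B] so that [rays_measure_unique] applies to it. *)
Definition integral_kernel (B : set T') : \bar R :=
  (\int[nu]_(x in A) kappa x B)%E.

Let integral_kernel0 : integral_kernel set0 = 0%E.
Proof. by apply: integral0_eq => x _; rewrite measure0. Qed.

Let integral_kernel_ge0 B : (0 <= integral_kernel B)%E.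
Proof. exact: integral_ge0. Qed.

Let integral_kernel_sigma_additive : semi_sigma_additive integral_kernel.
Proof.
move=> B mB tB mUB; rewrite [X in _ --> X](_ : _ =
  (\int[nu]_(x in A) (\sum_(n <oo) kappa x (B n)))%E); last first.
  apply: eq_integral => x _.
  by apply/esym/cvg_lim => //; exact/measure_semi_sigma_additive.
apply/cvg_closeP; split.
  by apply: is_cvg_nneseries => n _ _; exact: integral_ge0.
rewrite closeE// integral_nneseries// => n.
by apply: measurable_funTS; exact: mkappa.
Qed.

HB.instance Definition _ := isMeasure.Build _ _ _ integral_kernel
  integral_kernel0 integral_kernel_ge0 integral_kernel_sigma_additive.

End integral_kernel.

Section gap_kernel_law.
Context d (T : measurableType d) (R : realType) (P : probability T R) (n : nat).
Context (X : 'I_n -> {RV P >-> R}) (F : R -> R).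
Hypothesis indX : mutually_independent P X.
Hypothesis XF : forall l x, cdf (X l) x = (F x)%:E.
Hypothesis X0 : forall l x, P (X l @^-1` [set x]) = 0%E.
Variables (m : nat) (phi : 'I_m -> 'I_n).
Hypothesis phi_inj : injective phi.

Let X' l := X (phi l).
Let s := [seq phi l | l <- enum 'I_m].

Let us : uniq s. Proof. by rewrite map_inj_uniq ?enum_uniq. Qed.

Let ss : size s = m. Proof. by rewrite size_map size_enum_ord. Qed.

Let countsetE x y r w :
  countset (fun l => X l @^-1` [set` Interval -oo%O (BSide false x)])
    (fun l => X l @^-1` ([set` Interval (BSide false x) +oo%O] `&` `]x + y, +oo[))
    s 0 r w <->
  exceed X' x w /\ (r <= count (fun l => (x + y < X' l w)%R) (enum 'I_m))%N.
Proof.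
have e1 l : (w \in X l @^-1` [set` Interval -oo%O (BSide false x)]) = (X l w <= x).
  by apply/idP/idP => [/set_mem|h]; [|apply/mem_set]; rewrite /= in_itv.
have e2 l : (w \in X l @^-1` ([set` Interval (BSide false x) +oo%O] `&` `]x + y, +oo[)) =
    (x < X l w) && (x + y < X l w).
  apply/idP/idP => [/set_mem[/=]|/andP[h1 h2]].
    by rewrite !in_itv/= !andbT => -> ->.
  by apply/mem_set; split; rewrite /= in_itv/= andbT.
rewrite /countset /= (eq_count e1) [X in (_ <= X)%N](eq_count e2) /s !(count_map phi).
split=> [[/eqP]|[xX rX]].
  rewrite -leqn0 leqNgt -has_count => /hasPn xX.
  have {}xX : exceed X' x w.
    by move=> l; rewrite ltNge; apply: xX; rewrite mem_enum.
  by move=> /leq_trans rX; split => //; apply: rX; apply: sub_count => l /= /andP[].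
split.
  apply/eqP; rewrite -leqn0 leqNgt -has_count; apply/hasPn => l _ /=.
  by rewrite -ltNge; exact: xX.
apply: (leq_trans rX); apply: sub_count => l /= ->.
by rewrite andbT; exact: xX.
Qed.

(** All observations exceed x when none falls in []-oo, x]], a count equal to 0; by [order_stat_gt]
    the gap is a count of those above x + y. *)
Lemma gap_measure_ray j x y : (1 <= j <= m)%N ->
  gap_measure X' (order_stat X' j) x `]y, +oo[%classic =
  (count_prob (F x) (1 - F (x + Num.max 0 y)) (F (x + Num.max 0 y) - F x)
    m 0 (m - j).+1)%:E.
Proof.
move=> jm.
have := prob_countset_rays indX XF X0 (fun=> false) x y 0 (m - j).+1 us.
rewrite ss => <-; congr (P _); apply/seteqP; split => w.
  move=> [xX]; rewrite /= in_itv/= andbT ltrBrDl order_stat_gt// => c.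
  exact/countsetE.
by move=> /countsetE[xX c]; split; rewrite //= in_itv/= andbT ltrBrDl order_stat_gt.
Qed.

Lemma gap_measureT Z x :
  gap_measure X' Z x setT = ((1 - F x) ^+ m)%:E.
Proof.
have := prob_countset_rays indX XF X0 (fun=> false) x 0 0 0 us.
rewrite ss count_prob0 addrA subrK => <-.
congr (P _); apply/seteqP; split => w.
  by move=> [xX _]; apply/countsetE.
by move=> /countsetE[].
Qed.

End gap_kernel_law.

(** Where [mu] has mass zero, [mnormalize] takes the default value [Q], but both sides vanish. *)
Lemma mnormalizeE d (T : measurableType d) (R : realType)
    (mu : {measure set T -> \bar R}) (Q : probability T R) B :
  (mu setT < +oo)%E -> measurable B ->
  (mu B = mu setT * mnormalize mu Q B)%E.
Proof.
move=> muoo mB; rewrite /mnormalize; case: ifPn => [/orP[/eqP mu0|/eqP muy]|].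
- rewrite mu0 mul0e; apply/eqP; rewrite eq_le measure_ge0 andbT -mu0.
  by apply: le_measure; rewrite ?inE.
- by rewrite muy ltxx in muoo.
rewrite negb_or => /andP[mu0 _].
have fmu : mu setT \is a fin_num by rewrite ge0_fin_numE.
rewrite muleCA -[X in (_ * (X * _))%E](fineK fmu) -EFinM divff ?mule1//.
by apply: contra mu0 => /eqP h; rewrite -(fineK fmu) h.
Qed.

(** * Positive regression dependence of the gap *)

Section order_stat_gap.
Context (R : realType) (disp : measure_display)
    (T : measurableType disp) (P : probability T R)
    (d : nat) (X : 'I_d -> {RV P >-> R}) (F f : R -> R)
    (indX : mutually_independent P X)
    (XF : forall (k : 'I_d) (x : R), cdf (X k) x = (F x)%:E)
    (dfrF : DFR F) (Ff : is_density F f)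
    (i j : nat) (i1 : (1 <= i)%N) (ij : (i < j)%N) (jd : (j <= d)%N).

Let k0 : 'I_d := Ordinal (leq_trans (leq_ltn_trans (leq0n i) ij) jd).
Let X0 k x : P (X k @^-1` [set x]) = 0%E := density_no_atom (XF k) Ff x.
Let mu : {measure set R -> \bar R} := distribution P (X k0).
Let nu : {measure set R -> \bar R} := distribution P (order_stat X i).
Let F01 x : 0 <= F x <= 1 := cdf_itv01 (XF k0) x.
Let mF : measurable_fun [set: R] F := measurable_cdf (XF k0).

Let i1d : (1 <= i <= d)%N.
Proof. by rewrite i1 (leq_trans _ jd)// ltnW. Qed.

Let Y l := X (widen_ord (leq_subr i d) l).
Let Z := order_stat Y (j - i).

(** The first d - i variables serve as the observations conditioned to exceed x. The Dirac mass is
    the default where F x = 1, which [DFR_survival_gt0] excludes on the support of F. *)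
Definition gap_given : R.-pker measurableTypeR R ~> measurableTypeR R :=
  knormalize (gap_kernel Y Z) \d_(0 : measurableTypeR R).

Let jim : (1 <= j - i <= d - i)%N.
Proof. by rewrite subn_gt0 ij leq_sub2r. Qed.

Let gapT x : gap_measure Y Z x setT = ((1 - F x) ^+ (d - i))%:E.
Proof.
rewrite /Y (gap_measureT indX XF X0)// => a b /(congr1 val) /= ab.
exact: val_inj.
Qed.

Let gap_ray x y : gap_measure Y Z x `]y, +oo[%classic =
  (count_prob (F x) (1 - F (x + Num.max 0 y)) (F (x + Num.max 0 y) - F x)
    (d - i) 0 (d - j).+1)%:E.
Proof.
rewrite /Z /Y (gap_measure_ray indX XF X0 _ x y jim); last first.
  by move=> a b /(congr1 val) /= ab; exact: val_inj.
(* As (d - i) - (j - i) = d - j, the threshold is the one in [prob_order_stat_gap]. *)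
by congr (count_prob _ _ _ _ _ _.+1)%:E; lia.
Qed.

Let gap_givenE x B : measurable B ->
  (gap_measure Y Z x B = ((1 - F x) ^+ (d - i))%:E * gap_given x B)%E.
Proof. by move=> mB; rewrite -gapT; apply: mnormalizeE => //; rewrite [ltLHS]gapT ltry. Qed.

Let h x : R := d%:R * 'C(d.-1, i.-1)%:R * F x ^+ i.-1.

Let h0 x : 0 <= h x.
Proof. by rewrite /h !mulr_ge0 ?ler0n// exprn_ge0//; have /andP[] := F01 x. Qed.

Let mh : measurable_fun [set: R] h.
Proof. by apply: measurable_funM => //; exact: measurable_funX. Qed.

(** For fixed [A] both sides are finite measures in [B], so that rays suffice. *)
Lemma gap_given_regular : is_regular_conditional_distribution (P := P)
  (order_stat X j \- order_stat X i) (order_stat X i) gap_given.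
Proof.
move=> A B mA mB.
have mXA : measurable (order_stat X i @^-1` A).
  exact: measurable_funPTI.
rewrite setIC.
(* [R] and [measurableTypeR R] have the same measurable sets, but their structures
   do not unify: the next two rewrites select the latter. *)
rewrite -[LHS]/(@pushforward _ _ T (measurableTypeR R) R (mrestr P mXA)
  (order_stat X j \- order_stat X i) B).
rewrite -[RHS]/(@integral_kernel _ _ R (measurableTypeR R) R nu A gap_given B).
apply: rays_measure_unique => //.
- exact: (measurable_funPT (order_stat X j \- order_stat X i)).
- by move=> C mC; exact: (measurable_kernel gap_given C mC).
- move=> mgap; apply: (@le_lt_trans _ _ 1%E); last exact: ltry.
  by apply: (@probability_le1 _ _ _ P); rewrite preimage_setT setTI.
move=> mgap mker y.
have gapE := prob_order_stat_gap indX XF X0 k0 y i1 ij jd mA.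
rewrite setIC in gapE; apply: (etrans gapE).
have mg : measurable_fun [set: R] (fun x => h x * (1 - F x) ^+ (d - i)).
  by apply: measurable_funM => //; apply: measurable_funX; exact: measurable_funB.
have g0 x : 0 <= h x * (1 - F x) ^+ (d - i).
  rewrite mulr_ge0// exprn_ge0// subr_ge0.
  by have /andP[] := F01 x.
have nuE C : measurable C ->
    (nu C = \int[mu]_(x in C) (h x * (1 - F x) ^+ (d - i))%:E)%E.
  by move=> mC; exact: (prob_order_stat indX XF X0 k0).
have mk : measurable_fun [set: R] (fun x => gap_given x `]y, +oo[%classic).
  by move=> C mC; exact: (measurable_kernel gap_given `]y, +oo[%classic).
(* The density of [nu] contains the factor (1 - F x)^(d - i), exactly the mass removed by the
   normalisation; their product restores the unnormalised measure of the ray. *)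
apply: etrans (esym (ge0_integral_density mg g0 nuE mA mk _)) => //.
apply: eq_integral => x _; rewrite EFinM -/(h x) -gap_ray gap_givenE//.
by rewrite -/(h x) [in RHS]EFinM muleA muleC.
Qed.

(** The law of X_(i) has a density with respect to the law of one observation, so an interval on
    which F is flat is null for both. *)
Lemma cdf_support_order_stat x :
  cdf_support (fine \o cdf (order_stat X i : {RV P >-> R})) x -> cdf_support F x.
Proof.
move=> Sx e e0; have := Sx e e0; rewrite !ltNge; apply: contra => Fe.
have xe : x - e <= x + e by lra.
have Fxe : F (x + e) = F (x - e).
  by apply/le_anti; rewrite Fe (cdf_nondecr (XF k0)).
have split_cdf (W : {RV P >-> R}) : (cdf W (x + e)%R = cdf W (x - e)%R +
    distribution P W `](x - e)%R, (x + e)%R])%E.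
  rewrite {1}/cdf (@itv_bndbnd_setU _ _ _ (BRight (x - e)))// ?bnd_simp//.
  rewrite measureU//; apply/seteqP; split => // z [/=].
  by rewrite !in_itv/= => zx /andP[/lt_le_trans/(_ zx)]; rewrite ltxx.
have mu0 : mu `]x - e, x + e]%classic = 0%E.
  have := split_cdf (X k0); rewrite !XF Fxe.
  have : distribution P (X k0) `]x - e, x + e]%classic \is a fin_num.
    exact: fin_num_measure.
  rewrite -[mu _]/(distribution P (X k0) _).
  by case: (distribution P (X k0) _) => // r _ [h1]; congr (_%:E); lra.
rewrite /= split_cdf (prob_order_stat indX XF X0 k0)//.
rewrite (null_set_integral _ _ mu0) ?adde0//.
apply: measurable_funTS; apply/measurable_EFinP; apply: measurable_funM => //.
by apply: measurable_funX; exact: measurable_funB.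
Qed.

(** Both weights have the factor [survival F x]; by [count_probZ] it comes out to the power d - i
    and cancels the normalising mass. *)
Lemma gap_given_ray x y : 0 <= y -> 0 < survival F x ->
  gap_given x `]y, +oo[%classic =
  (count_prob 0 (survival F (x + y) / survival F x)
    (1 - survival F (x + y) / survival F x) (d - i) 0 (d - j).+1)%:E.
Proof.
move=> y0 Fx0.
have Fx : survival F x != 0 by rewrite gt_eqF.
have : (gap_measure Y Z x `]y, +oo[%classic = (survival F x ^+ (d - i))%:E *
    gap_given x `]y, +oo[%classic)%E by rewrite gap_givenE.
rewrite gap_ray (max_idPr y0).
rewrite (_ : 1 - F (x + y) = survival F x * (survival F (x + y) / survival F x)); last first.
  by rewrite mulrC divfK.
rewrite (_ : F (x + y) - F x =
    survival F x * (1 - survival F (x + y) / survival F x)); last first.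
  by rewrite mulrBr mulr1 mulrC divfK// /survival; ring.
rewrite count_probZ EFinM (count_prob_0 _ 0) => /esym.
have sF : survival F x ^+ (d - i) != 0 by rewrite expf_neq0.
move=> /(congr1 (fun z => ((survival F x ^+ (d - i))^-1)%:E * z)%E).
by rewrite !muleA -!EFinM mulVf// !mul1r mul1e.
Qed.

Lemma PRD_order_stat_gap :
  PRD P (order_stat X j \- order_stat X i) (order_stat X i).
Proof.
exists gap_given; first exact: gap_given_regular.
move=> y y0 x1 x2 /set_mem/cdf_support_order_stat Sx1.
move=> /set_mem/cdf_support_order_stat Sx2 x12.
have s1 := DFR_survival_gt0 (XF k0) dfrF Ff Sx1.
have s2 := DFR_survival_gt0 (XF k0) dfrF Ff Sx2.
rewrite !gap_given_ray// lee_fin; apply: count_prob_homo.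
- rewrite divr_ge0// ?(ltW s1)// subr_ge0.
  by have /andP[] := F01 (x1 + y).
- exact: (dfrF y0 (mem_set (conj Sx1 s1)) (mem_set (conj Sx2 s2)) x12).
rewrite ler_pdivrMr// mul1r lerD2l lerN2.
by apply: (cdf_nondecr (XF k0)); rewrite lerDl.
Qed.

End order_stat_gap.

Unset Implicit Arguments.
Set Strict Implicit.
Set Printing Implicit Defensive.

Theorem proposition11 (R : realType) (disp : measure_display)
    (T : measurableType disp) (P : probability T R)
    (d : nat) (hd : (2 <= d)%N)
    (X : 'I_d -> {RV P >-> R}) (F f : R -> R)
    (hindep : mutually_independent P X)
    (hF : forall (k : 'I_d) (x : R), cdf (X k) x = (F x)%:E)
    (hDFR : DFR F) (hf : is_density F f)
    (i j : nat) (hi : (1 <= i)%N) (hij : (i < j)%N) (hj : (j <= d)%N) :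
  PRD P (order_stat X j \- order_stat X i) (order_stat X i).
Proof. exact: PRD_order_stat_gap hDFR hf i j hi hij hj. Qed.
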